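(* Let $\mathcal{B}$ be the class of functions $f\in L^2(\mathbb{R})$ (real- or complex-valued) that are band-limited to $[-1,1]$ and satisfy $|f(x)|\le 1$ for all $x\le 0$. For $x>0$ define $$M(x)=\sup_{f\in\mathcal{B}}|f(x)|.$$ Then $M(x)=\infty$ for all $x>0$.
   Context: A function $f\in L^2(\mathbb{R})$ is band-limited to $[-1,1]$ if its Fourier transform $F(k)=\frac{1}{2\pi}\int_{-\infty}^{\infty} f(x)e^{-ikx}\,dx$ (in the $L^2$ sense) has compact support in $[-1,1]$, so that $f(x)=\int_{-\infty}^{\infty}F(k)e^{ikx}\,dk$ with $F\in L^2(\mathbb{R})$ supported in $[-1,1]$. By the Paley-Wiener theorem this is equivalent to: $f\in L^2(\mathbb{R})$ extends to an entire function of $z=x+iy$ satisfying $|f(z)|\le Ce^{|y|}$ for all $z\in\mathbb{C}$, for some constant $C>0$ (depending on $f$). Such an $f$ is identified with its continuous (entire) representative, given for every $x\in\mathbb{R}$ by the integral formula above, so that the pointwise values $f(x)$ are well defined. *)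

(* Defs.v *)
From mathcomp Require Import all_boot all_order all_algebra.
From mathcomp Require Import all_classical all_reals all_analysis.
From mathcomp.real_closed Require Import complex.

Set Implicit Arguments.
Unset Strict Implicit.
Unset Printing Implicit Defensive.

Import Order.TTheory GRing.Theory Num.Theory.
Import numFieldTopology.Exports numFieldNormedType.Exports.
Import Normc.

Local Open Scope classical_set_scope.
Local Open Scope ring_scope.
Local Open Scope complex_scope.

Section BandLimited.
Variable R : realType.
Local Notation mu := (@lebesgue_measure R).
Implicit Types (f F : R -> R[i]).

Definition cexpi (t : R) : R[i] := cos t +i* sin t.

Definition cintegral (D : set R) f : R[i] :=
  (\int[mu]_(x in D) complex.Re (f x)) +i* (\int[mu]_(x in D) complex.Im (f x)).

Definition cmeasurable f : Prop :=
  measurable_fun setT (fun x => complex.Re (f x)) /\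
  measurable_fun setT (fun x => complex.Im (f x)).

Definition L2norm f : \bar R := ('N[mu]_2[EFin \o (@normc R \o f)])%E.

Definition L2 f : Prop := cmeasurable f /\ (L2norm f < +oo)%E.

Definition truncated_fourier f (n : nat) (k : R) : R[i] :=
  ((2 * pi)^-1)%:C *
  cintegral `[- n%:R, n%:R] (fun x => f x * cexpi (- (k * x))).

(* The Fourier transform of a square-integrable [f] is the limit in L^2 of the
   transforms of its truncations to [-n, n]; it is determined up to a null
   set only. *)
Definition L2_fourier f F : Prop :=
  L2 F /\
  (fun n => L2norm (fun k => F k - truncated_fourier f n k)) @ \oo --> 0%E.

Definition supported_in (A : set R) F : Prop :=
  {ae mu, forall k, ~ A k -> F k = 0}.

(* The last conjunct selects, in the L^2-class of [f], the continuous (entire)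
   representative, so that the values [f x] are meaningful. *)
Definition band_limited f : Prop :=
  L2 f /\
  exists F, [/\ L2_fourier f F,
    supported_in `[-1, 1] F &
    forall x, f x = cintegral setT (fun k => F k * cexpi (k * x))].

Definition classB : set (R -> R[i]) :=
  [set f | band_limited f /\ forall x, x <= 0 -> normc (f x) <= 1].

Definition classB_real : set (R -> R[i]) :=
  [set f | classB f /\ forall x, complex.Im (f x) = 0].

Definition sup_abs_at (B : set (R -> R[i])) (x : R) : \bar R :=
  ereal_sup [set (normc (f x))%:E | f in B].

End BandLimited.

(* Main.v *)
Require Import Defs.
From mathcomp Require Import all_boot all_order all_algebra.
From mathcomp Require Import all_classical all_reals all_analysis.
From mathcomp Require Import measurable_realfun.
From mathcomp.real_closed Require Import complex.
From mathcomp Require Import ring lra.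

Set Implicit Arguments.
Unset Strict Implicit.
Unset Printing Implicit Defensive.

Import Order.TTheory GRing.Theory Num.Theory.
Import numFieldTopology.Exports numFieldNormedType.Exports.
Import Normc.

(** The members of the class that are large at [x] are translates of

      I_q(u) = int_[-1, 1] cos(pi l / 2)^(2 q) cos(l u) dl,

    the transform of an even function that vanishes to order [2 q] at both
    ends of [-1, 1].  Integrating by parts twice relates [I_(q+1)] to [I_q]
    ([cosT_cospow_rec]), so that, up to a constant factor,

      I_q(u) = sin u / (u * prod_(1 <= j <= q) (u^2 - (j pi)^2)):

    the zeros of [sin] in [-q pi, q pi] are removed.  Put
    [a = (q + 1) pi], the first remaining zero.  The denominator increases
    beyond [a], so if [c] is its absolute value at [a] then [c] times the
    quotient is bounded by 1 on [u <= - a].  Moving from [- a] to the right by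
    a fixed [y] in ]0, pi[ divides the denominator by at least
    [prod_(1 <= j <= q) (1 + y / (j pi)) >= 1 + (y / pi) (1 + 1/2 + ... + 1/q)]
    ([zeros_poly_ratio]), and the numerator becomes [sin y] in absolute value.
    As the harmonic series diverges, the value at [y - a] is unbounded in [q].
    A translation by at least [a] moves the half-line [u <= - a] over
    [x <= 0] and the point [y - a] to the given point
    ([classB_real_unbounded]).

    It remains to see that these functions are band-limited in the sense of
    L^2-limits of truncated transforms ([band_limited_cosT]).  The recurrence
    and its derivative show that [I_q] and its derivative are [O(1 / u^2)].
    Hence an antiderivative of [I_q(u) cos(k u)] has a limit, with an error
    at [X] of order [1 / (X (1 + |k|))] by one integration by parts
    ([primitive_tail]); the L^2 norm in [k] of this error tends to 0 as [X]
    grows.  The limit itself is identified pointwise by Abel summation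
    with the factor [exp(- e u)], which produces the Poisson kernel
    ([primitive_limit]). *)

(** * Continuous and differentiable functions of a real variable *)

Section calculus.
Local Open Scope classical_set_scope.
Local Open Scope ring_scope.
Variable R : realType.
Local Notation mu := (@lebesgue_measure R).
Implicit Types f g F G : R -> R.

Lemma is_derive_continuous f (f' : R -> R) :
  (forall x : R, is_derive x 1 f (f' x)) -> continuous f.
Proof.
move=> df x; apply/differentiable_continuous; rewrite -derivable1_diffP.
by case: (df x).
Qed.

Lemma continuous_compR f g : continuous f -> continuous g ->
  continuous (fun x => g (f x)).
Proof. by move=> cf cg x; apply: continuous_comp; [exact: cf|exact: cg]. Qed.

Lemma continuous_mulR f g : continuous f -> continuous g ->
  continuous (fun x => f x * g x).
Proof. by move=> cf cg x; apply: cvgM; [exact: cf|exact: cg]. Qed.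

Lemma continuous_addR f g : continuous f -> continuous g ->
  continuous (fun x => f x + g x).
Proof. by move=> cf cg x; apply: cvgD; [exact: cf|exact: cg]. Qed.

Lemma continuous_subR f g : continuous f -> continuous g ->
  continuous (fun x => f x - g x).
Proof. by move=> cf cg x; apply: cvgB; [exact: cf|exact: cg]. Qed.

Lemma continuous_cstR (a : R) : continuous (fun _ : R => a).
Proof. by move=> x; exact: cvg_cst. Qed.

Lemma continuous_idR : continuous (fun x : R => x).
Proof. by move=> x; exact: cvg_id. Qed.

Lemma continuous_normr f : continuous f -> continuous (fun x => `|f x|).
Proof.
by move=> cf x; apply: continuous_comp; [exact: cf|exact: norm_continuous].
Qed.

Lemma continuous_integrable_itv f (a b : R) :
  continuous f -> mu.-integrable `[a, b] (EFin \o f).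
Proof.
move=> cf; apply: continuous_compact_integrable; first exact: segment_compact.
exact: continuous_subspaceT.
Qed.

Lemma Rintegral_FTC2 f F (a b : R) : a <= b -> continuous f ->
  (forall x : R, is_derive x 1 F (f x)) ->
  \int[mu]_(x in `[a, b]) f x = F b - F a.
Proof.
rewrite le_eqVlt => /predU1P[<- _ _|ab cf dF].
  by rewrite set_itv1 Rintegral_set1 subrr.
have cF := is_derive_continuous dF.
rewrite /Rintegral (@continuous_FTC2 _ f F)//.
- exact: continuous_subspaceT.
- split.
  + by move=> x _; case: (dF x).
  + exact/cvg_at_right_filter/cF.
  + exact/cvg_at_left_filter/cF.
- by move=> x _; rewrite derive1E; case: (dF x).
Qed.

Lemma antiderivative f : mu.-integrable setT (EFin \o f) -> continuous f ->
  exists F : R -> R, forall x : R, is_derive x 1 F (f x).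
Proof.
move=> intf cf; exists (fun x => \int[mu]_(t in `]-oo, x]) f t) => x.
have intf' : mu.-integrable `]-oo, (x + 1)] (EFin \o f).
  exact: integrableS intf.
have [||dF F'] := continuous_FTC1 (a := -oo%O) (x := x) _ intf' _ (cf x).
- by rewrite ltrDl.
- by rewrite ltNyr.
- by split; [exact: dF|rewrite -derive1E; exact: F'].
Qed.

(** The mean value theorem applied to [G - F] and [G + F]. *)
Lemma mean_value_inequality F G f g (a b : R) : a <= b ->
  (forall x : R, a <= x <= b -> is_derive x 1 F (f x)) ->
  (forall x : R, a <= x <= b -> is_derive x 1 G (g x)) ->
  (forall x, a <= x <= b -> `|f x| <= g x) ->
  `|F b - F a| <= G b - G a.
Proof.
move=> ab dF dG fg.
have mono (H h : R -> R) :
    (forall x : R, a <= x <= b -> is_derive x 1 H (h x)) ->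
    (forall x, a <= x <= b -> 0 <= h x) -> H a <= H b.
  move=> dH h0; have dH' x : x \in `]a, b[ -> is_derive x 1 H (h x).
    by rewrite in_itv/= => /andP[ax xb]; apply: dH; rewrite !ltW.
  have cH : {within `[a, b], continuous H}.
    by apply: derivable_within_continuous => x /[!in_itv]/= xab;
      case: (dH _ xab).
  have [c] := MVT_segment ab dH' cH; rewrite in_itv/= => cab HE.
  by rewrite -subr_ge0 HE mulr_ge0 ?subr_ge0 ?h0.
have := mono (G - F) (g - f).
have := mono (G + F) (g + f).
rewrite /= => H1 H2.
have {}H1 : G a + F a <= G b + F b.
  apply: H1 => x xab; first by have := dF _ xab; have := dG _ xab => ? ?;
    exact: is_deriveD.
  by rewrite !fctE; have := fg _ xab; rewrite ler_norml => /andP[]; lra.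
have {}H2 : G a - F a <= G b - F b.
  apply: H2 => x xab; first by have := dF _ xab; have := dG _ xab => ? ?;
    exact: is_deriveB.
  by rewrite !fctE; have := fg _ xab; rewrite ler_norml => /andP[]; lra.
by rewrite ler_norml; apply/andP; split; lra.
Qed.

Lemma is_deriveVx (x : R) : x != 0 ->
  is_derive x 1 (fun y : R => y^-1) (- x ^- 2).
Proof.
move=> x0; have := @is_deriveV R id x 1 1 x0 _.
move=> /(_ (is_derive_id _ _)) H; apply: is_derive_eq.
by rewrite scaler1.
Qed.

(** Comparison of [F] with [- K / x]. *)
Lemma increment_decay_le F f (K a b : R) : 0 < a -> a <= b ->
  (forall x : R, is_derive x 1 F (f x)) ->
  (forall x, a <= x -> (1 + x ^+ 2) * `|f x| <= K) -> `|F b - F a| <= K / a.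
Proof.
move=> a0 ab dF fK.
have K0 : 0 <= K by apply: le_trans (fK a (lexx a));
  rewrite mulr_ge0// addr_ge0// sqr_ge0.
have b0 : 0 < b by exact: lt_le_trans ab.
apply: (@le_trans _ _ (- K * b^-1 - - K * a^-1)); last first.
  by rewrite mulNr mulNr opprK gerDr oppr_le0 divr_ge0// ltW.
apply: (@mean_value_inequality F (fun x => - K * x^-1) f (fun x => K * x ^- 2))
  => //.
- move=> x /andP[ax _]; have x0 : x != 0 by rewrite gt_eqF// (lt_le_trans a0).
  have := is_deriveVx x0 => ?.
  have H := @is_deriveZ R R R (fun y : R => y^-1) (- K) x 1 (- x ^- 2) _.
  apply: is_derive_eq; rewrite /GRing.scale/=; ring.
- move=> x /andP[ax _]; have x0 : 0 < x by rewrite (lt_le_trans a0).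
  rewrite ler_pdivlMr ?exprn_gt0//; apply: le_trans (fK x ax).
  by rewrite mulrC ler_wpM2r// lerDr.
Qed.

End calculus.

(** * Cosine and sine transforms over [-1, 1] *)

Section transforms.
Local Open Scope classical_set_scope.
Local Open Scope ring_scope.
Variable R : realType.
Local Notation mu := (@lebesgue_measure R).
Implicit Types f g : R -> R.

Lemma is_derive_Rintegral (phi dphi : R -> R -> R) (M u : R) :
  (forall v, continuous (phi v)) ->
  (forall v l : R, is_derive v 1 (phi ^~ l) (dphi v l)) ->
  (forall v l, u - 1 < v < u + 1 -> -1 <= l <= 1 -> `|dphi v l| <= M) ->
  is_derive u 1 (fun v => \int[mu]_(l in `[-1, 1]) phi v l)
    (\int[mu]_(l in `[-1, 1]) dphi u l).
Proof.
move=> cphi dphiP phiM.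
have M0 : 0 <= M by apply: le_trans (phiM u 0 _ _); rewrite //; lra.
have E v l : partial1of2 phi v l = dphi v l.
  by rewrite partial1of2E; case: (dphiP v l).
have uI : `](u - 1), (u + 1)[%classic u by rewrite /= in_itv/=; lra.
have intphi v : `](u - 1), (u + 1)[%classic v ->
    mu.-integrable `[-1, 1] (EFin \o phi v).
  by move=> _; exact: continuous_integrable_itv.
have derphi v l : `](u - 1), (u + 1)[%classic v -> `[-1, 1]%classic l ->
  derivable (phi ^~ l) v 1 by move=> _ _; case: (dphiP v l).
have intM : mu.-integrable `[-1, 1] (EFin \o (fun=> M)).
  by apply: continuous_integrable_itv => x; exact: cvg_cst.
have ubM v l : `](u - 1), (u + 1)[%classic v -> `[-1, 1]%classic l ->
    `|partial1of2 phi v l| <= M.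
  by rewrite /= !in_itv/= E; exact: phiM.
split.
  exact: (@derivable_under_integral R _ _ mu phi `[-1, 1] _ u _ _ uI intphi
    derphi _ (fun=> M0) intM ubM).
rewrite -derive1E.
rewrite (@differentiation_under_integral R _ _ mu phi `[-1, 1] _ u _ _ uI
  intphi derphi _ (fun=> M0) intM ubM)//.
by apply: eq_Rintegral => l _; exact: E.
Qed.

Lemma normr_Rintegral_itv_le (a b : R) f (M : R) : a <= b -> continuous f ->
  (forall l, a <= l <= b -> `|f l| <= M) ->
  `|\int[mu]_(l in `[a, b]) f l| <= M * (b - a).
Proof.
move=> ab cf fM.
have intf := @continuous_integrable_itv R f a b cf.
apply: le_trans (le_normr_Rintegral _ intf) _ => //.
rewrite (_ : M * (b - a) = \int[mu]_(l in `[a, b]) M); last first.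
  rewrite Rintegral_cst//; have /= -> := @lebesgue_measure_itv R `[a, b];
    rewrite lte_fin.
  by move: ab; rewrite le_eqVlt => /predU1P[->|->];
    rewrite ?ltxx ?subrr//= mulr0.
apply: le_Rintegral => //.
- exact/continuous_integrable_itv/continuous_normr.
- by apply: continuous_integrable_itv => x; exact: cvg_cst.
Qed.

Lemma Rintegral_oppr f : continuous f ->
  \int[mu]_(l in `[-1, 1]) f (- l) = \int[mu]_(l in `[-1, 1]) f l.
Proof.
move=> cf; rewrite /Rintegral; congr fine.
have N11 : (-1 : R) <= 1 by lra.
have := @integration_by_substitution_oppr R f (-1) 1 N11;
  rewrite opprK => -> //.
exact: continuous_subspaceT.
Qed.

Lemma Rintegral_odd f : continuous f -> (forall l, f (- l) = - f l) ->
  \int[mu]_(l in `[-1, 1]) f l = 0.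
Proof.
move=> cf of_; have := Rintegral_oppr cf.
under eq_Rintegral do rewrite of_ -mulN1r.
rewrite RintegralZl//; last exact: continuous_integrable_itv.
lra.
Qed.

Lemma continuous_cos_mul (u : R) : continuous (fun l : R => cos (l * u)).
Proof.
move=> l; apply: continuous_comp; last exact: continuous_cos.
by apply: cvgMl; exact: cvg_id.
Qed.

Lemma continuous_sin_mul (u : R) : continuous (fun l : R => sin (l * u)).
Proof.
move=> l; apply: continuous_comp; last exact: continuous_sin.
by apply: cvgMl; exact: cvg_id.
Qed.

Definition cosT g (u : R) : R := \int[mu]_(l in `[-1, 1]) (g l * cos (l * u)).
Definition sinT g (u : R) : R := \int[mu]_(l in `[-1, 1]) (g l * sin (l * u)).

Lemma is_derive_cos_mul (a x : R) :
  is_derive x 1 (fun y : R => cos (a * y)) (- a * sin (a * x)).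
Proof. by apply: is_derive_eq; rewrite /GRing.scale/=; ring. Qed.

Lemma is_derive_sin_mul (a x : R) :
  is_derive x 1 (fun y : R => sin (a * y)) (a * cos (a * x)).
Proof. by apply: is_derive_eq; rewrite /GRing.scale/=; ring. Qed.

Lemma is_derive_cosT g (B : R) : continuous g -> (forall l, `|g l| <= B) ->
  forall u : R, is_derive u 1 (cosT g) (- sinT (fun l => l * g l) u).
Proof.
move=> cg gB u.
have cgl : continuous (fun l : R => l * g l).
  by move=> l; apply: cvgM; [exact: cvg_id|exact: cg].
have -> : - sinT (fun l => l * g l) u =
    \int[mu]_(l in `[-1, 1]) (- (l * g l * sin (l * u))).
  under eq_Rintegral do rewrite -mulN1r.
  rewrite RintegralZl ?mulN1r//.
  apply: continuous_integrable_itv => l; apply: cvgM; first exact: cgl.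
  exact: continuous_sin_mul.
apply: (@is_derive_Rintegral (fun u l => g l * cos (l * u))
  (fun u l => - (l * g l * sin (l * u))) B).
- by move=> v l; apply: cvgM; [exact: cg|exact: continuous_cos_mul].
- move=> v l.
  by apply: is_derive_eq; rewrite /GRing.scale/=; ring.
- move=> v l _ l1; rewrite normrN 2!normrM.
  rewrite -[leRHS]mulr1 [leLHS](_ : _ = `|g l| * (`|l| * `|sin (l * v)|));
    last by ring.
  rewrite ler_pM ?mulr_ge0// mulr_ile1 ?sin_max//.
  by rewrite ler_norml.
Qed.

Lemma normr_cosT_le g (B : R) : continuous g -> (forall l, `|g l| <= B) ->
  forall u, `|cosT g u| <= B * 2.
Proof.
move=> cg gB u; rewrite (_ : 2 = 1 - (-1) :> R); last by lra.
apply: normr_Rintegral_itv_le; first lra.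
  by move=> l; apply: cvgM; [exact: cg|exact: continuous_cos_mul].
move=> l _; rewrite normrM -[leRHS]mulr1 ler_pM// cos_max//.
Qed.

Lemma normr_sinT_le g (B : R) : continuous g -> (forall l, `|g l| <= B) ->
  forall u, `|sinT (fun l => l * g l) u| <= B * 2.
Proof.
move=> cg gB u; rewrite (_ : 2 = 1 - (-1) :> R); last by lra.
apply: normr_Rintegral_itv_le; first lra.
  move=> l; apply: cvgM; last exact: continuous_sin_mul.
  by apply: cvgM; [exact: cvg_id|exact: cg].
move=> l l1; rewrite !normrM.
rewrite [leLHS](_ : _ = `|g l| * (`|l| * `|sin (l * u)|)); last by ring.
by rewrite -[leRHS]mulr1 ler_pM ?mulr_ge0// mulr_ile1 ?sin_max// ler_norml.
Qed.

Lemma cosTN g u : cosT g (- u) = cosT g u.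
Proof. by apply: eq_Rintegral => l _; rewrite mulrN cosN. Qed.

Lemma sinT_even g u : continuous g -> (forall l, g (- l) = g l) -> sinT g u = 0.
Proof.
move=> cg eg; apply: Rintegral_odd.
  by move=> l; apply: cvgM; [exact: cg|exact: continuous_sin_mul].
by move=> l; rewrite eg mulNr sinN mulrN.
Qed.

End transforms.

(** * Transforms of even powers of the cosine *)

Section cosine_powers.
Local Open Scope classical_set_scope.
Local Open Scope ring_scope.
Variable R : realType.
Local Notation mu := (@lebesgue_measure R).

Definition cospow (p : nat) (l : R) : R := cos (pi / 2 * l) ^+ p.*2.

Lemma continuous_cospow p : continuous (cospow p).
Proof.
move=> l; apply: (@continuous_comp _ _ _ (fun l : R => cos (pi / 2 * l))
  (fun y => y ^+ p.*2)).
  have := @continuous_cos_mul R (pi / 2) l.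
  by under [X in continuous_at _ X -> _]eq_fun do rewrite mulrC.
exact: exprn_continuous.
Qed.

Lemma normr_cospow_le1 p l : `|cospow p l| <= 1.
Proof. by rewrite normrX exprn_ile1// cos_max. Qed.

Lemma cospowN p l : cospow p (- l) = cospow p l.
Proof. by rewrite /cospow mulrN cosN. Qed.

Lemma cospow1 p : cospow p.+1 1 = 0.
Proof. by rewrite /cospow mulr1 cos_pihalf expr0n. Qed.

Lemma cosT_cospow0 u : u * cosT (cospow 0) u = 2 * sin u.
Proof.
have cf : continuous (fun l : R => u * cos (l * u)).
  by move=> l; apply: cvgM; [exact: cvg_cst|exact: continuous_cos_mul].
have dF (l : R) : is_derive l 1 (fun l => sin (l * u)) (u * cos (l * u)).
  by apply: is_derive_eq; rewrite /GRing.scale/=; ring.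
have N11 : (-1 : R) <= 1 by lra.
have := Rintegral_FTC2 N11 cf dF.
rewrite RintegralZl//; last by apply: continuous_integrable_itv;
  exact: continuous_cos_mul.
rewrite mul1r mulN1r sinN opprK -mulr2n mulr_natl => <-.
by congr (_ * _); apply: eq_Rintegral => l _; rewrite /cospow expr0 mul1r.
Qed.

Local Instance is_derive_cos_mulX (a l : R) (n : nat) :
  is_derive l 1 (fun l : R => cos (a * l) ^+ n.+1)
    (- (n.+1%:R * a) * cos (a * l) ^+ n * sin (a * l)).
Proof.
have := is_derive_cos_mul a l => H.
rewrite (_ : (fun _ => _) = (fun l : R => cos (a * l)) ^+ n.+1); last first.
  by apply/funext => y; rewrite fctE.
by apply: is_derive_eq; rewrite /GRing.scale/=; ring.
Qed.

(** Two integrations by parts: [cospow p.+1] vanishes to second order at the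
    ends of [-1, 1], and its second derivative combines [cospow p.+1] and
    [cospow p]. *)
Lemma cosT_cospow_rec p u :
  (u ^+ 2 - (p.+1%:R * pi) ^+ 2) * cosT (cospow p.+1) u =
  - (pi ^+ 2 / 4 * (p.*2.+2)%:R * (p.*2.+1)%:R) * cosT (cospow p) u.
Proof.
pose k : R := pi ^+ 2 / 4 * (p.*2.+2)%:R * (p.*2.+1)%:R.
pose d : R := u ^+ 2 - (p.+1%:R * pi) ^+ 2.
pose q l : R :=
  k * (cospow p l * cos (l * u)) + d * (cospow p.+1 l * cos (l * u)).
(* with g = cospow p.+1, this is g' cos(l u) + u g sin(l u), whose derivative is
   (g'' + u^2 g) cos(l u) *)
pose Q l : R := - (p.*2.+2)%:R * (pi / 2) * cos (pi / 2 * l) ^+ p.*2.+1 *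
    sin (pi / 2 * l) * cos (l * u) +
  u * cos (pi / 2 * l) ^+ p.*2.+2 * sin (l * u).
have cT n : continuous (fun l : R => cospow n l * cos (l * u)).
  by move=> l; apply: cvgM;
    [exact: continuous_cospow|exact: continuous_cos_mul].
have cTZ n (a : R) : continuous (fun l : R => a * (cospow n l * cos (l * u))).
  by move=> l; apply: cvgM; [exact: cvg_cst|exact: cT].
have cq : continuous q by move=> l; apply: cvgD; exact: cTZ.
have dQ (l : R) : is_derive l 1 Q (q l).
  rewrite /Q /q /k /d /cospow doubleS; apply: is_derive_eq.
  rewrite /GRing.scale/=.
  set c := cos (pi / 2 * l); set s := sin (pi / 2 * l).
  have s2 : s ^+ 2 = 1 - c ^+ 2 by exact: sin2cos2.
  have -> : (p.+1%:R * pi : R) = p.*2.+2%:R * (pi / 2).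
    by rewrite -doubleS -muln2 natrM; field.
  rewrite !(exprS c p.*2.+1) !(exprS c p.*2); set w := c ^+ p.*2;
    rewrite -!natr1.
  set N : R := p.*2%:R.
  transitivity (pi ^+ 2 / 4 * (N + 1 + 1) * (N + 1) * w * s ^+ 2 * cos (l * u)
    - pi ^+ 2 / 4 * (N + 1 + 1) * w * c ^+ 2 * cos (l * u)
    + u ^+ 2 * c ^+ 2 * w * cos (l * u)); first by field.
  by rewrite s2; field.
have N11 : (-1 : R) <= 1 by lra.
have := Rintegral_FTC2 N11 cq dQ.
rewrite /Q !mulr1 !mulrN1 cosN cos_pihalf !expr0n/= !(mulr0, mul0r, add0r,
  subr0) oppr0.
rewrite RintegralD//; try exact: continuous_integrable_itv.
rewrite !RintegralZl//; try exact: continuous_integrable_itv.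
rewrite -/(cosT (cospow p) u) -/(cosT (cospow p.+1) u) -/k -/d.
by rewrite mulNr => /eqP; rewrite addrC addr_eq0 => /eqP.
Qed.

(** The transforms that occur in the recurrence and in its derivative are bounded
    by 2, and those with index [p.+1] have [u ^+ 2] as a coefficient. *)
Lemma cosT_cospow_decay p : exists K, forall u,
  (1 + u ^+ 2) * `|cosT (cospow p.+1) u| <= K /\
  (1 + u ^+ 2) * `|sinT (fun l => l * cospow p.+1 l) u| <= K.
Proof.
set I := cosT (cospow p.+1); set I0 := cosT (cospow p).
set J := sinT (fun l => l * cospow p.+1 l);
  set J0 := sinT (fun l => l * cospow p l).
pose k : R := pi ^+ 2 / 4 * (p.*2.+2)%:R * (p.*2.+1)%:R.
pose d : R := (p.+1%:R * pi) ^+ 2.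
have k0 : 0 <= k by rewrite !mulr_ge0 ?invr_ge0 ?ler0n ?pi_ge0.
have d0 : 0 <= d by rewrite sqr_ge0.
have rec u : (u ^+ 2 - d) * I u = - k * I0 u by exact: cosT_cospow_rec.
clearbody k d.
have b n u : `|cosT (cospow n) u| <= 2.
  by rewrite -[2]mul1r; apply: normr_cosT_le;
    [exact: continuous_cospow|exact: normr_cospow_le1].
have b' n u : `|sinT (fun l => l * cospow n l) u| <= 2.
  by rewrite -[2]mul1r; apply: normr_sinT_le;
    [exact: continuous_cospow|exact: normr_cospow_le1].
have dI n (u : R) : is_derive u 1 (cosT (cospow n))
    (- sinT (fun l => l * cospow n l) u).
  by apply: (@is_derive_cosT _ _ 1);
    [exact: continuous_cospow|exact: normr_cospow_le1].
have rec' u : 2 * u * I u - (u ^+ 2 - d) * J u = k * J0 u.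
  have D1 : is_derive u 1 (fun v => (v ^+ 2 - d) * I v)
      (2 * u * I u - (u ^+ 2 - d) * J u).
    have := dI p.+1 u => ?.
    by apply: is_derive_eq; rewrite /GRing.scale/= -/I -/J; ring.
  have D2 : is_derive u 1 (fun v => - k * I0 v) (k * J0 u).
    have := dI p u => ?.
    by apply: is_derive_eq; rewrite /GRing.scale/= -/J0; ring.
  have E : (fun v => (v ^+ 2 - d) * I v) = (fun v => - k * I0 v).
    by apply/funext => v; exact: rec.
  by move: D1; rewrite E => -[_ <-]; case: D2.
exists (2 * (2 + 2 * d + 2 * k)) => u.
have H : (1 + u ^+ 2) * `|I u| <= 2 + 2 * d + 2 * k.
  have -> : (1 + u ^+ 2) * `|I u| = `|(1 + d) * I u - k * I0 u|.
    rewrite -[1 + u ^+ 2]ger0_norm ?addr_ge0 ?sqr_ge0// -normrM; congr `|_|.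
    by have := rec u; lra.
  rewrite (le_trans (ler_normB _ _))// !normrM (ger0_norm k0) ger0_norm
    ?addr_ge0//.
  by have := b p.+1 u; have := b p u; rewrite -/I -/I0; nra.
split; first by apply: le_trans H _; lra.
have -> : (1 + u ^+ 2) * `|J u| = `|(1 + d) * J u - k * J0 u + 2 * u * I u|.
  rewrite -[1 + u ^+ 2]ger0_norm ?addr_ge0 ?sqr_ge0// -normrM; congr `|_|.
  by have := rec' u; lra.
have uI : `|2 * u * I u| <= 2 + 2 * d + 2 * k.
  apply: le_trans H; rewrite normrM ler_wpM2r//.
  by have := sqr_ge0 (u - 1); have := sqr_ge0 (u + 1); rewrite ler_norml; lra.
rewrite (le_trans (ler_normD _ _))// (le_trans (lerD (ler_normB _ _) uI))//.
rewrite !normrM (ger0_norm k0) (@ger0_norm _ (1 + d)) ?addr_ge0//.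
by have := b' p.+1 u; have := b' p u; rewrite -/J -/J0; nra.
Qed.

End cosine_powers.

(** * The Poisson kernel *)

Section fourier_inversion.
Local Open Scope classical_set_scope.
Local Open Scope ring_scope.
Variable R : realType.
Local Notation mu := (@lebesgue_measure R).
Implicit Types f g h : R -> R.

Definition poisson (e b : R) : R := e / (e ^+ 2 + b ^+ 2).

Lemma poisson_den_gt0 (e b : R) : 0 < e -> 0 < e ^+ 2 + b ^+ 2.
Proof. by move=> e0; rewrite ltr_pwDl ?exprn_gt0 ?sqr_ge0. Qed.

Lemma continuous_poisson (e k : R) : 0 < e ->
  continuous (fun l : R => poisson e (l - k)).
Proof.
move=> e0 l; apply: cvgM; first exact: cvg_cst.
apply: cvgV; first by rewrite gt_eqF// poisson_den_gt0.
apply: cvgD; first exact: cvg_cst.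
apply: (@continuous_comp _ _ _ (fun l : R => l - k) (fun y => y ^+ 2)).
  by apply: cvgB; [exact: cvg_id|exact: cvg_cst].
exact: exprn_continuous.
Qed.

Lemma Rintegral_poisson (e k a b : R) : 0 < e -> a <= b ->
  \int[mu]_(l in `[a, b]) poisson e (l - k) =
  atan ((b - k) / e) - atan ((a - k) / e).
Proof.
move=> e0 ab; apply: (Rintegral_FTC2 (F := fun l => atan ((l - k) / e))) => //.
  exact: continuous_poisson.
move=> l; apply: is_derive_eq; rewrite /GRing.scale/= /poisson.
have := poisson_den_gt0 (l - k) e0; have := e0.
move=> /lt0r_neq0 e1 /lt0r_neq0 d1.
have d2 : 1 + ((l - k) / e) ^+ 2 != 0 by rewrite gt_eqF// ltr_pwDl ?sqr_ge0.
have -> : 1 + ((l - k) / e) ^+ 2 = (e ^+ 2 + (l - k) ^+ 2) / e ^+ 2 by field.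
by field; rewrite e1 d1.
Qed.

(** Near [k] the values of [h] are close to [h k], and away from [k] the kernel
    is [O(e)]. *)
Lemma poisson_limit h (B k d : R) : continuous h -> (forall l, `|h l| <= B) ->
  0 < d -> exists2 e0, 0 < e0 & forall e, 0 < e -> e <= e0 ->
  `|\int[mu]_(l in `[- (`|k| + 1), `|k| + 1]) (h l * poisson e (l - k))
    - pi * h k| <= d.
Proof.
move=> ch hB d0.
have B0 : 0 <= B by apply: le_trans (hB 0).
set W := `|k| + 1; have W1 : 1 <= W by rewrite lerDr.
have /andP[kW1 kW2] : - W + 1 <= k <= W - 1.
  by rewrite opprD subrK addrK -ler_norml.
have NWW : - W < W by lra.
have WW := ltW NWW.
have [eta eta0 heta] : exists2 eta : R, 0 < eta &
    forall l, `|l - k| < eta -> `|h l - h k| <= d / 12.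
  have /cvgrPdist_le/(_ (d / 12)) := ch k.
  rewrite divr_gt0// => /(_ isT)[eta /= eta0 hk]; exists eta => // l lk.
  by rewrite distrC; apply: hk; rewrite /= distrC.
have [A A0 atanA] : exists2 A : R, 0 < A &
    forall x, A <= x -> pi / 2 - d / (6 * (B + 1)) <= atan x.
  have /cvgrPdist_le/(_ (d / (6 * (B + 1)))) := @cvgy_atan R.
  rewrite divr_gt0 ?mulr_gt0 ?ltr_wpDl// => /(_ isT)[A [_ hA]].
  exists (`|A| + 1); first by rewrite ltr_wpDl.
  move=> x Ax; have /hA : A < x.
    by apply: lt_le_trans Ax; rewrite (le_lt_trans (ler_norm A))// ltrDl.
  by move=> /(le_trans (ler_norm _)); lra.
pose e1 := d * eta ^+ 2 / (12 * (B * W + 1)).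
have BW0 : 0 <= B * W by rewrite mulr_ge0//; lra.
have e10 : 0 < e1 by rewrite divr_gt0 ?mulr_gt0 ?exprn_gt0//; lra.
exists (Num.min e1 A^-1) => [|e e0]; first by rewrite lt_min e10 invr_gt0.
rewrite le_min => /andP[ee1 eA].
pose P l := poisson e (l - k).
have cP : continuous P by exact: continuous_poisson.
have P0 l : 0 <= P l by rewrite divr_ge0 ?ltW// poisson_den_gt0.
have intP : \int[mu]_(l in `[- W, W]) P l = atan ((W - k) / e) - atan ((- W -
  k) / e).
  exact: Rintegral_poisson.
have Pfar l : eta <= `|l - k| -> P l <= e / eta ^+ 2.
  move=> lk; rewrite /P /poisson ler_wpM2l ?(ltW e0)//.
  rewrite ler_pV2 ?inE ?unitf_gt0 ?exprn_gt0 ?poisson_den_gt0//.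
  rewrite -[(l - k) ^+ 2]real_normK ?num_real//.
  by rewrite -[leLHS]add0r lerD ?sqr_ge0// ler_pXn2r ?nnegrE ?(ltW eta0).
change (`|\int[mu]_(l in `[- W, W]) (h l * P l) - pi * h k| <= d);
  clearbody P W.
have chP : continuous (fun l => h l * P l) by move=> l; apply: cvgM;
  [exact: ch|exact: cP].
have E : \int[mu]_(l in `[- W, W]) (h l * P l) =
    \int[mu]_(l in `[- W, W]) ((h l - h k) * P l) + h k * \int[mu]_(l in `[- W,
      W]) P l.
  rewrite -RintegralZl//; last exact: continuous_integrable_itv.
  rewrite -RintegralD//.
  - by apply: eq_Rintegral => l _; ring.
  - apply: continuous_integrable_itv => l; apply: cvgM; last exact: cP.
    by apply: cvgB; [exact: ch|exact: cvg_cst].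
  - apply: continuous_integrable_itv => l.
    by apply: cvgM; [exact: cvg_cst|exact: cP].
have bnd l : `|(h l - h k) * P l| <= d / 12 * P l + 2 * B * e / eta ^+ 2.
  rewrite normrM (ger0_norm (P0 l)).
  have [lk|lk] := ltP `|l - k| eta.
    rewrite -[leLHS]addr0 lerD//; first by rewrite ler_wpM2r// heta.
    by rewrite divr_ge0 ?sqr_ge0// mulr_ge0 ?(ltW e0)// mulr_ge0.
  rewrite -[leLHS]add0r lerD//; first by rewrite mulr_ge0// divr_ge0 ?(ltW d0).
  rewrite -[leRHS]mulrA ler_pM//.
    by rewrite (le_trans (ler_normB _ _))// mulr_natl mulr2n lerD.
  exact: Pfar.
have I1 : `|\int[mu]_(l in `[- W, W]) ((h l - h k) * P l)| <=
    d / 12 * \int[mu]_(l in `[- W, W]) P l + 2 * B * e / eta ^+ 2 * (W - (- W)).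
  have cint : continuous (fun l => (h l - h k) * P l).
    move=> l; apply: cvgM; last exact: cP.
    by apply: cvgB; [exact: ch|exact: cvg_cst].
  have cZ : continuous (fun l => d / 12 * P l).
    by move=> l; apply: cvgM; [exact: cvg_cst|exact: cP].
  have cc (a : R) : continuous (fun l : R => a) by move=> l; exact: cvg_cst.
  have intint := @continuous_integrable_itv R _ (- W) W cint.
  apply: le_trans (le_normr_Rintegral _ intint) _ => //.
  rewrite -RintegralZl//; last exact: continuous_integrable_itv.
  rewrite (_ : _ / eta ^+ 2 * (W - - W) =
      \int[mu]_(l in `[- W, W]) (2 * B * e / eta ^+ 2)); last first.
    rewrite Rintegral_cst//; have /= -> := @lebesgue_measure_itv R `[- W, W].
    by rewrite lte_fin NWW.
  rewrite -RintegralD//; [|exact: continuous_integrable_itv..].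
  apply: le_Rintegral => //.
  - exact/continuous_integrable_itv/continuous_normr.
  - by apply: continuous_integrable_itv => l; apply: cvgD;
    [exact: cZ|exact: cc].
move: E I1 intP; set I0 := \int[mu]_(l in _) _; set I1 := \int[mu]_(l in _) _.
set IP := \int[mu]_(l in _) _; move: I0 I1 IP => I0 I1 IP E I1b intP.
have /andP[PW1 PW2] : pi - d / (3 * (B + 1)) <= IP <= pi.
  have K1 : A <= (W - k) / e.
    rewrite (@le_trans _ _ e^-1)//;
      last by rewrite ler_peMl ?invr_ge0 ?(ltW e0)//; lra.
    by rewrite -[A]invrK ler_pV2// inE ?unitf_gt0 ?invr_gt0.
  have K2 : A <= - ((- W - k) / e).
    rewrite (@le_trans _ _ e^-1)//; last first.
      by rewrite -mulNr ler_peMl ?invr_ge0 ?(ltW e0)//; lra.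
    by rewrite -[A]invrK ler_pV2// inE ?unitf_gt0 ?invr_gt0.
  have := atanA _ K1; have := atanA _ K2; rewrite atanN intP.
  have := atan_ltpi2 ((W - k) / e); have := atan_gtNpi2 ((- W - k) / e).
  have -> : d / (3 * (B + 1)) = 2 * (d / (6 * (B + 1))) by field; lra.
  lra.
have pi4 : pi <= 4 :> R by have := @pihalf_lt2 R; lra.
have Q1 : d / 12 * IP <= d / 3.
  rewrite (@le_trans _ _ (d / 12 * 4))//; last by lra.
  by rewrite ler_wpM2l//; lra.
have Q2 : 2 * B * e / eta ^+ 2 * (W - (- W)) <= d / 3.
  rewrite opprK mulrAC ler_pdivrMr ?exprn_gt0//.
  have : e * (12 * (B * W + 1)) <= d * eta ^+ 2.
    by rewrite -ler_pdivlMr//; lra.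
  nra.
have Q3 : `|h k * IP - pi * h k| <= d / 3.
  have IPpi : `|IP - pi| <= d / (3 * (B + 1)) by rewrite ler0_norm; lra.
  have : B * (d / (3 * (B + 1))) <= d / 3.
    by rewrite mulrA ler_pdivrMr; nra.
  apply: le_trans; rewrite (mulrC pi) -mulrBr normrM.
  by rewrite ler_pM.
rewrite E -addrA (le_trans (ler_normD _ _))//.
by apply: (@le_trans _ _ (d / 3 + d / 3 + d / 3));
  [rewrite lerD// (le_trans I1b)// lerD|lra].
Qed.

End fourier_inversion.

(** * Fourier inversion by Abel summation *)

Section abel_inversion.
Local Open Scope classical_set_scope.
Local Open Scope ring_scope.
Variable R : realType.
Local Notation mu := (@lebesgue_measure R).

(** [g] on [-1, 1]; the extension is continuous, and zero elsewhere when [g]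
    vanishes at both ends. *)
Definition cutoff (g : R -> R) (l : R) : R := g (Num.max (-1) (Num.min 1 l)).

Lemma continuous_cutoff g : continuous g -> continuous (cutoff g).
Proof.
move=> cg; apply: continuous_compR (cg) => l.
apply: (@continuous_max R R (fun=> -1) (fun l => Num.min 1 l));
  first exact: cvg_cst.
by apply: (@continuous_min R R (fun=> 1) id); [exact: cvg_cst|exact: cvg_id].
Qed.

Lemma cutoff_in g l : -1 <= l <= 1 -> cutoff g l = g l.
Proof. by move=> /andP[l1 l2]; rewrite /cutoff (min_idPr l2) (max_idPr l1). Qed.

Lemma cutoff_out g l : g (-1) = 0 -> g 1 = 0 -> ~~ (-1 <= l <= 1) -> cutoff g l
  = 0.
Proof.
move=> gN1 g1; rewrite /cutoff negb_and -!ltNge => /orP[l1|l1].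
  by rewrite (min_idPr _) ?(max_idPl _)//; lra.
by rewrite (min_idPl _) ?(max_idPr _)//; lra.
Qed.

Lemma Rintegral_cutoff g h (W : R) : g (-1) = 0 -> g 1 = 0 -> 1 <= W ->
  \int[mu]_(l in `[- W, W]) (cutoff g l * h l) =
  \int[mu]_(l in `[-1, 1]) (g l * h l).
Proof.
move=> gN1 g1 W1; rewrite Rintegral_mkcond [RHS]Rintegral_mkcond.
apply: eq_Rintegral => l _; rewrite !patchE !mem_setE !in_itv/=.
have [l1|l1] := boolP (-1 <= l <= 1).
  by rewrite cutoff_in// ifT//; lra.
by rewrite cutoff_out// mul0r; case: ifP.
Qed.

Variables (g : R -> R) (B K : R).
Hypothesis cg : continuous g.
Hypothesis gB : forall l, `|g l| <= B.
Hypothesis gN : forall l, g (- l) = g l.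
Hypothesis g1 : g 1 = 0.
Let I := cosT g.
Let I' := fun u => - sinT (fun l => l * g l) u.
Hypothesis IK : forall u, (1 + u ^+ 2) * `|I u| <= K.
Hypothesis I'K : forall u, (1 + u ^+ 2) * `|I' u| <= K.

Let B0 : 0 <= B. Proof. exact: le_trans (gB 0). Qed.
Let K0 : 0 <= K.
Proof. by apply: le_trans (IK 0); rewrite mulr_ge0// addr_ge0// sqr_ge0. Qed.
Let gN1 : g (-1) = 0. Proof. by rewrite gN. Qed.

Let dI (u : R) : is_derive u 1 I (I' u).
Proof. exact: is_derive_cosT. Qed.

Section regularization.
Variables (e k : R).
Hypothesis e0 : 0 < e.

(** The integral of [expR (- e * u) * cos (b * u)] for [u] in [0, X]. *)
Let kern (X b : R) : R :=
  (e + expR (- e * X) * (b * sin (X * b) - e * cos (X * b))) /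
  (e ^+ 2 + b ^+ 2).

Let Psi (X : R) : R := \int[mu]_(l in `[-1, 1]) (g l * kern X (l - k)).

Let continuous_kern X : continuous (fun l => g l * kern X (l - k)).
Proof.
have cb : continuous (fun l : R => l - k).
  by apply: continuous_subR; [exact: continuous_idR|exact: continuous_cstR].
have cXb : continuous (fun l : R => X * (l - k)).
  by apply: continuous_mulR => //; exact: continuous_cstR.
apply: continuous_mulR => //; apply: continuous_mulR.
  apply: continuous_addR; first exact: continuous_cstR.
  apply: continuous_mulR; first exact: continuous_cstR.
  apply: continuous_subR.
    by apply: continuous_mulR => //; apply: continuous_compR => //;
      exact: continuous_sin.
  apply: continuous_mulR; first exact: continuous_cstR.
  by apply: continuous_compR => //; exact: continuous_cos.
move=> l; apply: cvgV; first by rewrite gt_eqF// poisson_den_gt0.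
apply: cvgD; first exact: cvg_cst.
by apply: (@continuous_compR R (fun l => l - k) (fun y => y ^+ 2)) => //;
  exact: exprn_continuous.
Qed.

Let dPsi (X : R) : is_derive X 1 Psi (expR (- e * X) * (I X * cos (k * X))).
Proof.
pose dphi (X l : R) := g l * (expR (- e * X) * cos (X * (l - k))).
have -> : expR (- e * X) * (I X * cos (k * X)) =
    \int[mu]_(l in `[-1, 1]) dphi X l.
  rewrite /dphi.
  have E l : g l * (expR (- e * X) * cos (X * (l - k))) =
      expR (- e * X) * (cos (k * X) * (g l * cos (l * X)) +
                        sin (k * X) * (g l * sin (l * X))).
    by rewrite mulrBr cosB (mulrC X l) (mulrC X k); ring.
  under eq_Rintegral do rewrite E.
  have c1 : continuous (fun l : R => g l * cos (l * X)).
    by apply: continuous_mulR => //; exact: continuous_cos_mul.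
  have c2 : continuous (fun l : R => g l * sin (l * X)).
    by apply: continuous_mulR => //; exact: continuous_sin_mul.
  have cZ (a : R) (h : R -> R) : continuous h -> continuous (fun l : R => a * h
    l).
    by move=> ch; by apply: continuous_mulR => //; exact: continuous_cstR.
  rewrite RintegralZl//;
    last by apply/continuous_integrable_itv/continuous_addR; exact: cZ.
  rewrite RintegralD//; [|by apply/continuous_integrable_itv/cZ..].
  rewrite !RintegralZl//; [|exact: continuous_integrable_itv..].
  rewrite -/(sinT g X) sinT_even// mulr0 addr0 -/(cosT g X) -/I.
  by rewrite [cos _ * _]mulrC.
apply: (@is_derive_Rintegral R (fun X l => g l * kern X (l - k)) dphi
  (B * expR (e * (`|X| + 1)))).
- exact: continuous_kern.
- move=> v l; rewrite /kern /dphi; apply: is_derive_eq; rewrite /GRing.scale/=.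
  have := poisson_den_gt0 (l - k) e0 => /lt0r_neq0 d0.
  by field.
- move=> v l /andP[v1 v2] _; rewrite /dphi 2!normrM ler_pM ?mulr_ge0//.
  rewrite -[leRHS]mulr1 ler_pM ?cos_max// ger0_norm ?expR_ge0// ler_expR.
  rewrite mulNr -mulrN ler_wpM2l ?(ltW e0)//.
  by have := ler_norm (- X); rewrite normrN; lra.
Qed.

(** The exponential factor kills the oscillating part of [kern]. *)
Let Psi_poisson X :
  `|Psi X - \int[mu]_(l in `[-1, 1]) (g l * poisson e (l - k))| <=
  B * (2 / e) * expR (- e * X) * 2.
Proof.
have cP : continuous (fun l => g l * poisson e (l - k)).
  by apply: continuous_mulR => //; exact: continuous_poisson.
rewrite -RintegralB//; [|exact: continuous_integrable_itv..].
rewrite [X in _ * X](_ : 2 = 1 - (-1)); last by lra.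
apply: normr_Rintegral_itv_le; first lra.
  exact: continuous_subR.
move=> l _; set b := l - k.
have d0 : 0 < e ^+ 2 + b ^+ 2 by exact: poisson_den_gt0.
have -> : g l * kern X b - g l * poisson e b = g l *
    ((b * sin (X * b) - e * cos (X * b)) / (e ^+ 2 + b ^+ 2)) * expR (- e * X).
  by rewrite /kern /poisson; field; rewrite gt_eqF.
rewrite normrM (ger0_norm (expR_ge0 _)) ler_wpM2r ?expR_ge0//.
rewrite normrM ler_pM// normrM normfV (gtr0_norm d0) ler_pdivrMr//.
have : `|b * sin (X * b) - e * cos (X * b)| <= `|b| + e.
  rewrite (le_trans (ler_normB _ _))// !normrM (gtr0_norm e0) lerD//.
    by rewrite ler_piMr// sin_max.
  by rewrite ler_piMr ?cos_max// ltW.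
move=> /le_trans; apply.
rewrite mulrAC ler_pdivlMr// -(real_normK (num_real b)).
by have := normr_ge0 b; nra.
Qed.

Let Psi0 : Psi 0 = 0.
Proof.
rewrite /Psi; under eq_Rintegral => l _.
  rewrite /kern mulr0 expR0 !mul0r sin0 cos0 mulr0 mulr1 mul1r sub0r subrr
    mul0r mulr0.
  over.
by rewrite Rintegral_cst// mul0r.
Qed.

(** The regularizing factor changes little on [0, N] when [e] is small, and
    the decay of [cosT g] controls the rest. *)
Lemma primitive_poisson (H : R -> R) (N X : R) :
  (forall u : R, is_derive u 1 H (I u * cos (k * u))) -> 1 <= N -> N <= X ->
  `|H X - H 0 - \int[mu]_(l in `[-1, 1]) (g l * poisson e (l - k))| <=
  e * K * N ^+ 2 + K / N + B * (2 / e) * expR (- e * X) * 2.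
Proof.
move=> dH N1 NX; set P := Rintegral _ _ _.
pose D (u : R) : R := H u - Psi u.
pose f (u : R) : R := (1 - expR (- e * u)) * (I u * cos (k * u)).
have dD (u : R) : is_derive u 1 D (f u).
  have := dH u; have := dPsi u => ? ?.
  by apply: is_derive_eq; rewrite /f; ring.
have E0 u : 0 <= u -> 0 <= 1 - expR (- e * u) <= 1.
  move=> u0; rewrite subr_ge0 gerBl expR_ge0 andbT -expR0 ler_expR.
  by rewrite mulNr oppr_le0 mulr_ge0// ltW.
have fI u : 0 <= u -> `|f u| <= (1 - expR (- e * u)) * `|I u|.
  move=> /E0 /andP[E1 E2]; rewrite !normrM (ger0_norm E1) ler_wpM2l//.
  by rewrite ler_piMr// cos_max.
have IK' u : `|I u| <= K.
  apply: le_trans (IK u); rewrite ler_peMl// lerDl sqr_ge0//.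
have S1 : `|D N - D 0| <= e * K * N ^+ 2.
  rewrite (_ : e * K * N ^+ 2 = e * K * N * N - e * K * N * 0); last by ring.
  apply: (@mean_value_inequality R D (fun u => e * K * N * u) f (fun=> e * K *
    N)).
  - lra.
  - by move=> u _; apply: is_derive_eq; rewrite /GRing.scale/=; ring.
  - move=> u /andP[u0 uN]; apply: le_trans (fI u u0) _.
    have := E0 _ u0 => /andP[E1 E2].
    rewrite [leRHS]mulrAC ler_pM//.
    have := expR_ge1Dx (- e * u).
    have : e * u <= e * N by rewrite ler_wpM2l// ltW.
    by rewrite mulNr; lra.
have S2 : `|D X - D N| <= K / N.
  apply: (@increment_decay_le R D f) => //; first lra.
  move=> u Nu; have u0 : 0 <= u by lra.
  apply: le_trans (IK u); rewrite ler_wpM2l// ?addr_ge0 ?sqr_ge0//.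
  apply: le_trans (fI u u0) _; have := E0 _ u0 => /andP[E1 E2].
  by rewrite ler_piMl.
have S3 := Psi_poisson X.
have -> : H X - H 0 - P = (D N - D 0) + (D X - D N) + (Psi X - P).
  by rewrite /D Psi0; ring.
by rewrite (le_trans (ler_normD _ _))// lerD// (le_trans (ler_normD _ _))//
  lerD.
Qed.

End regularization.

(** In the bound of [primitive_poisson], [N] is chosen first, then [e], then
    [X]. *)
Lemma primitive_limit (k d : R) (H : R -> R) :
  (forall u : R, is_derive u 1 H (I u * cos (k * u))) -> 0 < d ->
  exists X0, forall X, X0 <= X -> `|H X - H 0 - pi * cutoff g k| <= d.
Proof.
move=> dH d0; have d4 : 0 < d / 4 by lra.
have [e0 e00 he0] := poisson_limit k (continuous_cutoff cg) (fun l => gB _) d4.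
pose N := 4 * K / d + 1.
have N1 : 1 <= N by rewrite lerDr divr_ge0 ?(ltW d0)// mulr_ge0.
have KN : K / N <= d / 4.
  rewrite ler_pdivrMr; last by lra.
  rewrite /N mulrDr mulr1 (_ : d / 4 * (4 * K / d) = K); first by lra.
  by field; rewrite gt_eqF.
pose e := Num.min e0 (d / (4 * (K * N ^+ 2 + 1))).
have KN0 : 0 <= K * N ^+ 2 by rewrite mulr_ge0// sqr_ge0.
have ep : 0 < e by rewrite lt_min e00 divr_gt0//; lra.
have eK : e * K * N ^+ 2 <= d / 4.
  have : e <= d / (4 * (K * N ^+ 2 + 1)) by rewrite ge_min lexx orbT.
  rewrite ler_pdivlMr; last by lra.
  rewrite -mulrA; nra.
exists (Num.max N (16 * B / (e ^+ 2 * d))) => X.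
rewrite ge_max => /andP[NX BX].
have X0 : 0 < X by lra.
have eX : B * (2 / e) * expR (- e * X) * 2 <= d / 4.
  have : expR (- e * X) <= (e * X)^-1.
    rewrite mulNr expRN ler_pV2 ?inE ?unitf_gt0 ?expR_gt0 ?mulr_gt0//.
    by apply: le_trans (expR_ge1Dx _); rewrite lerDr.
  move=> Ee; have : B * (2 / e) * expR (- e * X) * 2 <= B * (2 / e) * (e *
    X)^-1 * 2.
    by rewrite ler_wpM2r// ler_wpM2l// mulr_ge0// divr_ge0// ltW.
  move=> /le_trans; apply.
  rewrite (_ : _ * 2 = 4 * B / e ^+ 2 / X); last by field; rewrite !gt_eqF.
  rewrite ler_pdivrMr//.
  move: BX; rewrite ler_pdivrMr ?mulr_gt0 ?exprn_gt0// => BX.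
  by rewrite ler_pdivrMr ?exprn_gt0//; lra.
have := primitive_poisson ep dH N1 NX.
have := he0 e ep; rewrite ge_min lexx => /(_ isT).
rewrite Rintegral_cutoff ?lerDr//.
set P := Rintegral _ _ _; move: P => P P1 P2.
have -> : H X - H 0 - pi * cutoff g k = (H X - H 0 - P) + (P - pi * cutoff g k)
  by ring.
by rewrite (le_trans (ler_normD _ _))// (le_trans (lerD P2 P1))//; lra.
Qed.

(** The bound without [k] comes from the decay of [I], and the one with [`|k|]
    from an integration by parts.  In the applications [c] is a sine or a cosine
    of frequency [k], and [s] is bounded like [c]. *)
Lemma primitive_tail (k : R) (H c s : R -> R) (X Y : R) :
  (forall u : R, is_derive u 1 H (I u * c u)) ->
  (forall u : R, is_derive u 1 s (k * c u)) ->
  (forall u, `|c u| <= 1) -> (forall u, `|s u| <= 1) ->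
  1 <= X -> X <= Y -> (1 + `|k|) * `|H Y - H X| <= 4 * K / X.
Proof.
move=> dH ds c1 s1 X1 XY; have X0 : 0 < X by lra.
have IKle u : X <= u -> `|I u * s u| <= K / X.
  move=> Xu; rewrite normrM (@le_trans _ _ `|I u|) ?ler_piMr//.
  rewrite ler_pdivlMr// mulrC; apply: le_trans (IK u); rewrite ler_wpM2r//.
  by nra.
have T1 : `|H Y - H X| <= K / X.
  apply: (@increment_decay_le R H _ K X Y X0 XY dH) => u _.
  apply: le_trans (IK u); rewrite ler_wpM2l// ?addr_ge0 ?sqr_ge0//.
  by rewrite normrM ler_piMr.
pose V u := k * H u - I u * s u.
have T2 : `|V Y - V X| <= K / X.
  apply: (@increment_decay_le R V (fun u => - (I' u * s u)) K X Y X0 XY) => u.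
    have := dH u; have := ds u; have := dI u => ? ? ?.
    by apply: is_derive_eq; rewrite /GRing.scale/=; ring.
  move=> _; apply: le_trans (I'K u); rewrite ler_wpM2l// ?addr_ge0 ?sqr_ge0//.
  by rewrite normrN normrM ler_piMr.
have T3 : `|k| * `|H Y - H X| <= 3 * (K / X).
  rewrite -normrM (_ : k * _ = (V Y - V X) + I Y * s Y - I X * s X); last first.
    by rewrite /V; ring.
  rewrite (le_trans (ler_normB _ _))// (_ : 3 = 1 + 1 + 1); last by ring.
  rewrite !mulrDl mul1r lerD// ?IKle// (le_trans (ler_normD _ _))// lerD//
    IKle//.
by rewrite -mulrA mulrDl mul1r; lra.
Qed.

(** [primitive_tail] applied between [X] and a far point [Y], where the limit is
    almost attained. *)
Lemma primitive_limit_rate (k X : R) (H : R -> R) :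
  (forall u : R, is_derive u 1 H (I u * cos (k * u))) -> 1 <= X ->
  (1 + `|k|) * `|H X - H 0 - pi * cutoff g k| <= 4 * K / X.
Proof.
move=> dH X1; apply/ler_addgt0Pr => d d0.
have k0 : 0 < 1 + `|k| by rewrite ltr_pwDl.
have [X0 hX0] := primitive_limit dH (divr_gt0 d0 k0).
pose Y := Num.max X X0.
have XY : X <= Y by rewrite le_max lexx.
have /hX0 YX : X0 <= Y by rewrite le_max lexx orbT.
have ds (u : R) : is_derive u 1 (fun u => sin (k * u)) (k * cos (k * u)).
  exact: is_derive_sin_mul.
have T := primitive_tail dH ds (fun u => cos_max _) (fun u => sin_max _) X1 XY.
have -> : H X - H 0 - pi * cutoff g k =
  (H Y - H 0 - pi * cutoff g k) - (H Y - H X) by ring.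
rewrite (le_trans (ler_wpM2l (ltW k0) (ler_normB _ _)))// mulrDr addrC lerD//.
by rewrite mulrC -ler_pdivlMr.
Qed.

End abel_inversion.

(** * L2 bounds by decay *)

Section L2_tools.
Local Open Scope classical_set_scope.
Local Open Scope ring_scope.
Variable R : realType.
Local Notation mu := (@lebesgue_measure R).

Lemma oneDsqrV_ge0 (x : R) : 0 <= (oneDsqr x)^-1.
Proof. by rewrite invr_ge0 (le_trans ler01). Qed.

Lemma integralT_oneDsqrV : (\int[mu]_x ((oneDsqr x)^-1)%:E = pi%:E)%E.
Proof.
rewrite (@ge0_symfun_integralT R (fun x => (oneDsqr x)^-1)).
- rewrite (_ : [set x | 0 <= x] = `[0, +oo[%classic); last first.
    by apply/seteqP; split => x /=; rewrite in_itv/= andbT.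
  by rewrite integral0y_oneDsqr -EFinM; congr EFin; field.
- exact: oneDsqrV_ge0.
- exact: continuous_oneDsqrV.
- by move=> x; rewrite /= /oneDsqr sqrrN.
Qed.

Lemma measurable_oneDsqrV : measurable_fun setT (fun x : R => (oneDsqr x)^-1).
Proof. by apply: continuous_measurable_fun; exact: continuous_oneDsqrV. Qed.

Lemma integrable_decay (f : R -> R) (K : R) : continuous f ->
  (forall x, (1 + x ^+ 2) * `|f x| <= K) -> mu.-integrable setT (EFin \o f).
Proof.
move=> cf fK.
have iV : mu.-integrable setT (EFin \o (fun x : R => K * (oneDsqr x)^-1)).
  rewrite [X in _.-integrable _ X](_ : _ = (fun x => K%:E * ((oneDsqr
    x)^-1)%:E)%E); last first.
    by apply/funext => x; rewrite /= EFinM.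
  apply: integrableZl => //; apply/integrableP; split;
    first by apply/measurable_EFinP; exact: measurable_oneDsqrV.
  under eq_integral do rewrite /= ger0_norm ?oneDsqrV_ge0//.
  by rewrite integralT_oneDsqrV ltry.
apply: le_integrable iV => //.
  by apply/measurable_EFinP; exact: continuous_measurable_fun.
move=> x _; rewrite /= lee_fin ler_normr; apply/orP; left.
have d0 : 0 < oneDsqr x by rewrite (lt_le_trans ltr01).
by rewrite ler_pdivlMr// mulrC; exact: fK.
Qed.

(** Each simple function below [f1] is below [f2]. *)
Lemma ge0_le_integralT (f1 f2 : R -> \bar R) :
  (forall x, 0 <= f1 x)%E -> (forall x, f1 x <= f2 x)%E ->
  (\int[mu]_x f1 x <= \int[mu]_x f2 x)%E.
Proof.
move=> f10 f12; have f20 x : (0 <= f2 x)%E by exact: le_trans (f12 x).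
rewrite !ge0_integralTE//; apply: le_ereal_sup => _ [h hf1 <-].
by exists h => // x; exact: le_trans (f12 x).
Qed.

(** The square of [normc (h x)] is at most [A ^+ 2 / (1 + x ^+ 2)], whose
    integral is [A ^+ 2 * pi]. *)
Lemma L2norm_decay_le (h : R -> R[i]) (A : R) : 0 <= A ->
  (forall x, (1 + `|x|) * normc (h x) <= A) ->
  (L2norm h <= (A * Num.sqrt pi)%:E)%E.
Proof.
move=> A0 hA.
have nc0 x : 0 <= normc (h x) by case: (h x) => a b; exact: sqrtr_ge0.
rewrite /L2norm unlock.
apply: (@le_trans _ _ ((A ^+ 2 * pi)%:E `^ 2^-1)%E); last first.
  rewrite poweR_EFin lee_fin powR12_sqrt ?mulr_ge0 ?sqr_ge0 ?pi_ge0//.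
  by rewrite sqrtrM ?sqr_ge0// sqrtr_sqr ger0_norm.
apply: gt0_ler_poweR; first by rewrite invr_ge0.
- by rewrite in_itv/= leey andbT integral_ge0// => x _; exact: poweR_ge0.
- by rewrite in_itv/= leey andbT lee_fin mulr_ge0 ?sqr_ge0 ?pi_ge0.
rewrite EFinM -integralT_oneDsqrV -ge0_integralZl//; last first.
- by rewrite lee_fin sqr_ge0.
- by apply/measurable_EFinP; exact: measurable_oneDsqrV.
apply: ge0_le_integralT => x; first exact: poweR_ge0.
  have d0 : 0 < oneDsqr x by rewrite (lt_le_trans ltr01).
  rewrite /= -EFinM lee_fin (ger0_norm (nc0 x)) powR_mulrn//.
  rewrite ler_pdivlMr// /oneDsqr.
  have : ((1 + `|x|) * normc (h x)) ^+ 2 <= A ^+ 2.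
    by rewrite ler_pXn2r ?nnegrE ?mulr_ge0 ?addr_ge0.
  apply: le_trans; rewrite exprMn mulrC ler_wpM2r ?sqr_ge0//.
  by rewrite -(real_normK (num_real x)); have := normr_ge0 x; nra.
Qed.

End L2_tools.

(** * Band-limited functions from cosine transforms *)

Section band_limited_transform.
Local Open Scope classical_set_scope.
Local Open Scope ring_scope.
Variable R : realType.
Local Notation mu := (@lebesgue_measure R).
Local Open Scope complex_scope.

Lemma normc_le_sum (z : R[i]) : normc z <= `|complex.Re z| + `|complex.Im z|.
Proof.
case: z => a b /=; rewrite -[leRHS]ger0_norm ?addr_ge0// -sqrtr_sqr.
rewrite ler_sqrt ?sqr_ge0// sqrrD !real_normK ?num_real//.
by rewrite -addrA lerD2l lerDr mulrn_wge0// mulr_ge0.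
Qed.

Lemma ReM_real (a : R) (z : R[i]) : complex.Re (a%:C * z) = a * complex.Re z.
Proof. by case: z => c d /=; rewrite mul0r subr0. Qed.

Lemma ImM_real (a : R) (z : R[i]) : complex.Im (a%:C * z) = a * complex.Im z.
Proof. by case: z => c d /=; rewrite mul0r addr0. Qed.

Variables (g : R -> R) (B K : R).
Hypothesis cg : continuous g.
Hypothesis gB : forall l, `|g l| <= B.
Hypothesis gN : forall l, g (- l) = g l.
Hypothesis g1 : g 1 = 0.
Let I := cosT g.
Let I' := fun u => - sinT (fun l => l * g l) u.
Hypothesis IK : forall u, (1 + u ^+ 2) * `|I u| <= K.
Hypothesis I'K : forall u, (1 + u ^+ 2) * `|I' u| <= K.
Variable s : R.

Let B0 : 0 <= B. Proof. exact: le_trans (gB 0). Qed.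
Let K0 : 0 <= K.
Proof. by apply: le_trans (IK 0); rewrite mulr_ge0// addr_ge0// sqr_ge0. Qed.
Let gN1 : g (-1) = 0. Proof. by rewrite gN. Qed.
Let cI : continuous I.
Proof. exact: is_derive_continuous (is_derive_cosT cg gB). Qed.

Let cIs (h : R -> R) : continuous h -> continuous (fun x => I (x - s) * h x).
Proof.
move=> ch; apply: continuous_mulR => //.
apply: (@continuous_compR R (fun x => x - s)) => //.
by apply: continuous_subR; [exact: continuous_idR|exact: continuous_cstR].
Qed.

(** In the variable [u = x - s] the window is [- (N + s), N - s]; it is split at
    0, and the sine part over the overlap vanishes by parity. *)
Lemma Rintegral_window (k N : R) : 1 <= N - `|s| ->
  (1 + `|k|) * `|\int[mu]_(x in `[- N, N]) (I (x - s) * cos (k * x))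
     - 2 * pi * cutoff g k * cos (k * s)| <= 12 * K / (N - `|s|) /\
  (1 + `|k|) * `|\int[mu]_(x in `[- N, N]) (I (x - s) * sin (k * x))
     - 2 * pi * cutoff g k * sin (k * s)| <= 12 * K / (N - `|s|).
Proof.
set w := N - `|s|; move=> w1.
pose a := N - s; pose b := N + s.
have wa : w <= a by rewrite lerD2l lerN2 ler_norm.
have wb : w <= b by rewrite lerD2l lerNl; have := ler_norm (- s);
  rewrite normrN.
have w0 : 0 < w by rewrite (lt_le_trans ltr01).
have N0 : - N <= N by have := normr_ge0 s; rewrite /w in w1; lra.
have ck : continuous (fun u : R => cos (k * u)).
  apply: (@continuous_compR R (fun u => k * u) cos); last exact: continuous_cos.
  by apply: continuous_mulR; [exact: continuous_cstR|exact: continuous_idR].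
have sk : continuous (fun u : R => sin (k * u)).
  apply: (@continuous_compR R (fun u => k * u) sin); last exact: continuous_sin.
  by apply: continuous_mulR; [exact: continuous_cstR|exact: continuous_idR].
have prim (h : R -> R) : continuous h -> (forall u, `|h u| <= 1) ->
    exists H : R -> R, forall u : R, is_derive u 1 H (I u * h u).
  move=> ch h1; have cIh : continuous (fun u => I u * h u) by exact:
    continuous_mulR.
  apply: antiderivative => //; apply: (@integrable_decay R _ K) => // u.
  apply: le_trans (IK u); rewrite ler_wpM2l ?addr_ge0 ?sqr_ge0//.
  by rewrite normrM ler_piMr.
have [Hc dHc] := prim _ ck (fun u => cos_max _).
have [Hs dHs] := prim _ sk (fun u => sin_max _).
have K4 c : w <= c -> 4 * K / c <= 4 * K / w.
  move=> wc; have c0 : 0 < c by exact: lt_le_trans wc.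
  by rewrite ler_wpM2l ?mulr_ge0// ler_pV2 ?inE ?unitf_gt0.
have IN u : I (- u) = I u by exact: cosTN.
have A1 : (1 + `|k|) * `|Hc a - Hc 0 - pi * cutoff g k| <= 4 * K / w.
  apply: le_trans (K4 _ wa).
  exact: (primitive_limit_rate cg gB gN g1 IK I'K dHc (le_trans w1 wa)).
have A2 : (1 + `|k|) * `|- Hc (- b) + Hc 0 - pi * cutoff g k| <= 4 * K / w.
  have dH (u : R) : is_derive u 1 (fun v => - Hc (- v)) (I u * cos (k * u)).
    have := dHc (- u); rewrite IN mulrN cosN => ?.
    by apply: is_derive_eq; rewrite /GRing.scale/=; ring.
  apply: le_trans (K4 _ wb).
  have := primitive_limit_rate cg gB gN g1 IK I'K dH (le_trans w1 wb).
  by rewrite oppr0 opprK.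
have A3 : (1 + `|k|) * `|Hs a - Hs (- b)| <= 4 * K / w.
  have dD (u : R) : is_derive u 1 (fun v => Hs v - Hs (- v)) 0.
    have := dHs (- u); have := dHs u; rewrite IN mulrN sinN => ? ?.
    by apply: is_derive_eq; rewrite /GRing.scale/=; ring.
  have -> : Hs (- b) = Hs b.
    have := @is_derive_0_is_cst R (fun v => Hs v - Hs (- v)) b 0 dD.
    by rewrite oppr0 subrr => /eqP; rewrite subr_eq0 => /eqP.
  have ds (u : R) : is_derive u 1 (fun v => - cos (k * v)) (k * sin (k * u)).
    by apply: is_derive_eq; rewrite /GRing.scale/=; ring.
  have sb u : `|- cos (k * u)| <= 1 by rewrite normrN cos_max.
  have tail X Y := @primitive_tail R g B K cg gB IK I'K k Hs _ _ X Y dHs ds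
    (fun u => sin_max _) sb.
  have [ab|/ltW ba] := leP a b.
    by rewrite distrC; apply: le_trans (K4 _ wa); apply: tail => //;
      exact: le_trans wa.
  by apply: le_trans (K4 _ wb); apply: tail => //; exact: le_trans wb.
have k0 : 0 <= 1 + `|k| by rewrite addr_ge0.
have sum3 (c d x1 x2 x3 : R) : `|c| <= 1 -> `|d| <= 1 ->
    (1 + `|k|) * `|x1| <= 4 * K / w -> (1 + `|k|) * `|x2| <= 4 * K / w ->
    (1 + `|k|) * `|x3| <= 4 * K / w ->
    (1 + `|k|) * `|c * (x1 + x2) + d * x3| <= 12 * K / w.
  move=> c1 d1 h1 h2 h3.
  have : `|c * (x1 + x2) + d * x3| <= `|x1| + `|x2| + `|x3|.
    rewrite (le_trans (ler_normD _ _))// !normrM lerD ?ler_piMl//.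
    by rewrite (@le_trans _ _ `|x1 + x2|) ?ler_piMl// ler_normD.
  move=> /(ler_wpM2l k0) /le_trans; apply; rewrite !mulrDr.
  by rewrite (_ : 12 * K / w = 4 * K / w + 4 * K / w + 4 * K / w) ?lerD//; ring.
have NNs : - N - s = - b by rewrite opprD.
split.
- have dF (x : R) : is_derive x 1
      (fun y => cos (k * s) * Hc (y - s) - sin (k * s) * Hs (y - s))
      (I (x - s) * cos (k * x)).
    have := dHc (x - s); have := dHs (x - s) => ? ?.
    apply: is_derive_eq; rewrite /GRing.scale/=.
    by rewrite [in RHS](_ : k * x = k * (x - s) + k * s) ?cosD; ring.
  have -> := Rintegral_FTC2 N0 (cIs ck) dF.
  rewrite NNs -/a.
  have -> : cos (k * s) * Hc a - sin (k * s) * Hs a -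
      (cos (k * s) * Hc (- b) - sin (k * s) * Hs (- b)) -
      2 * pi * cutoff g k * cos (k * s) =
    cos (k * s) * ((Hc a - Hc 0 - pi * cutoff g k) +
                   (- Hc (- b) + Hc 0 - pi * cutoff g k)) +
    (- sin (k * s)) * (Hs a - Hs (- b)) by ring.
  by apply: sum3; rewrite // ?normrN ?cos_max ?sin_max.
- have dF (x : R) : is_derive x 1
      (fun y => sin (k * s) * Hc (y - s) + cos (k * s) * Hs (y - s))
      (I (x - s) * sin (k * x)).
    have := dHc (x - s); have := dHs (x - s) => ? ?.
    apply: is_derive_eq; rewrite /GRing.scale/=.
    by rewrite [in RHS](_ : k * x = k * (x - s) + k * s) ?sinD; ring.
  have -> := Rintegral_FTC2 N0 (cIs sk) dF.
  rewrite NNs -/a.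
  have -> : sin (k * s) * Hc a + cos (k * s) * Hs a -
      (sin (k * s) * Hc (- b) + cos (k * s) * Hs (- b)) -
      2 * pi * cutoff g k * sin (k * s) =
    sin (k * s) * ((Hc a - Hc 0 - pi * cutoff g k) +
                   (- Hc (- b) + Hc 0 - pi * cutoff g k)) +
    cos (k * s) * (Hs a - Hs (- b)) by ring.
  by apply: sum3; rewrite // ?normrN ?cos_max ?sin_max.
Qed.

Let f (x : R) : R[i] := (I (x - s))%:C.
Let F (k : R) : R[i] := (cutoff g k)%:C * cexpi (- (k * s)).

Let ReF k : complex.Re (F k) = cutoff g k * cos (k * s).
Proof. by rewrite ReM_real /= cosN. Qed.

Let ImF k : complex.Im (F k) = - (cutoff g k * sin (k * s)).
Proof. by rewrite ImM_real /= sinN mulrN. Qed.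

Let L2_f : L2 f.
Proof.
split.
  split; last exact: measurable_cst.
  apply: continuous_measurable_fun.
  have := @cIs (fun=> 1) (@continuous_cstR R 1).
  by under [X in continuous X -> _]eq_fun do rewrite mulr1.
have D0 : 0 <= (1 + `|s|) * (2 * K) by rewrite !mulr_ge0 ?addr_ge0.
apply: le_lt_trans (L2norm_decay_le D0 _) (ltry _) => x.
rewrite /f /= expr0n addr0 sqrtr_sqr.
set u := x - s.
have xu : 1 + `|x| <= (1 + `|s|) * (1 + `|u|).
  have : `|x| <= `|u| + `|s| by rewrite -[X in `|X|](subrK s) ler_normD.
  by have := normr_ge0 u; have := normr_ge0 s; nra.
apply: (@le_trans _ _ ((1 + `|s|) * (1 + `|u|) * `|I u|));
  first by rewrite ler_wpM2r.
rewrite -mulrA ler_wpM2l ?addr_ge0//.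
apply: (@le_trans _ _ (2 * ((1 + u ^+ 2) * `|I u|))); last by rewrite ler_wpM2l.
rewrite mulrA ler_wpM2r// -(real_normK (num_real u)).
by have := sqr_ge0 (1 - `|u|); nra.
Qed.

Let L2_F : L2 F.
Proof.
have cgb := continuous_cutoff cg.
split.
  split; apply: continuous_measurable_fun.
    rewrite (_ : (fun _ => _) = fun k => cutoff g k * cos (k * s)); last first.
      by apply/funext => k; rewrite ReF.
    by apply: continuous_mulR => //; exact: continuous_cos_mul.
  rewrite (_ : (fun _ => _) = fun k => -1 * (cutoff g k * sin (k * s)));
    last first.
    by apply/funext => k; rewrite ImF mulN1r.
  apply: continuous_mulR; first exact: continuous_cstR.
  by apply: continuous_mulR => //; exact: continuous_sin_mul.
have D0 : 0 <= 4 * B by rewrite mulr_ge0.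
apply: le_lt_trans (L2norm_decay_le D0 _) (ltry _) => k.
have [k1|k1] := boolP (-1 <= k <= 1); last first.
  by rewrite /F cutoff_out// mul0r /= expr0n addr0 sqrtr0 mulr0.
have kn : 1 + `|k| <= 2 by rewrite -ler_norml in k1; lra.
have Fk : normc (F k) <= 2 * B.
  apply: le_trans (normc_le_sum _) _; rewrite ReF ImF normrN !normrM.
  rewrite (_ : 2 * B = B + B); last by ring.
  by rewrite lerD// -[leRHS]mulr1 ler_pM ?cos_max ?sin_max// gB.
have Fk0 : 0 <= normc (F k) by case: (F k) => ? ?; exact: sqrtr_ge0.
have := normr_ge0 k; nra.
Qed.

Let truncated_fourierE n k : truncated_fourier f n k =
  ((2 * pi)^-1 * \int[mu]_(x in `[- n%:R, n%:R]) (I (x - s) * cos (k * x))) +i*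
  (- ((2 * pi)^-1 * \int[mu]_(x in `[- n%:R, n%:R]) (I (x - s) * sin (k * x)))).
Proof.
apply/eqP; rewrite eq_complex /truncated_fourier ReM_real ImM_real /=.
apply/andP; split; apply/eqP.
  by congr (_ * _); apply: eq_Rintegral => x _; rewrite mul0r subr0 cosN.
rewrite -mulrN; congr (_ * _); rewrite -[RHS]mulN1r -RintegralZl//.
  by apply: eq_Rintegral => x _; rewrite mul0r addr0 sinN mulrN mulN1r.
apply: continuous_integrable_itv; apply: cIs.
have := @continuous_sin_mul R k.
by under [X in continuous X -> _]eq_fun do rewrite mulrC.
Qed.

Let truncation_error n : 1 <= n%:R - `|s| ->
  (L2norm (fun k => F k - truncated_fourier f n k)%R <=
   (24 * K / (n%:R - `|s|) * Num.sqrt pi)%:E)%E.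
Proof.
move=> w1; have w0 : 0 < n%:R - `|s| by lra.
apply: L2norm_decay_le; first by rewrite divr_ge0 ?(ltW w0)// mulr_ge0.
move=> k; have [C S] := Rintegral_window k w1.
have k0 : 0 <= 1 + `|k| by rewrite addr_ge0.
have p0 : 0 < 2 * pi :> R by rewrite mulr_gt0 ?pi_gt0.
have p1 : (2 * pi)^-1 <= 1 :> R by rewrite invf_le1//; have := @pi_ge2 R; lra.
have scale (X Y : R) : `|Y - (2 * pi)^-1 * X| <= `|X - 2 * pi * Y|.
  rewrite (_ : Y - _ = - ((2 * pi)^-1 * (X - 2 * pi * Y))); last first.
    by rewrite mulrBr mulKf ?lt0r_neq0// opprB.
  by rewrite normrN normrM gtr0_norm ?invr_gt0// ler_piMl.
apply: le_trans (ler_wpM2l k0 (normc_le_sum _)) _.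
rewrite truncated_fourierE.
have -> (z : R[i]) (x y : R) : complex.Re (z - (x +i* y)) = complex.Re z - x by
  case: z.
have -> (z : R[i]) (x y : R) : complex.Im (z - (x +i* y)) = complex.Im z - y by
  case: z.
rewrite ReF ImF.
rewrite (_ : 24 * K / _ = 12 * K / (n%:R - `|s|) + 12 * K / (n%:R - `|s|));
  last by ring.
rewrite mulrDr lerD//.
  apply: le_trans C; rewrite ler_wpM2l// (le_trans (scale _ _))//.
  by rewrite !mulrA.
apply: le_trans S; rewrite ler_wpM2l// opprK addrC distrC.
by rewrite (le_trans (scale _ _))// !mulrA.
Qed.

Let L2_fourier_fF : L2_fourier f F.
Proof.
split; first exact: L2_F.
pose c := 24 * K * Num.sqrt pi * 4.
apply: (@squeeze_cvge _ _ _ _ (cst 0%E) _ (fun n => (c * harmonic n)%:E)).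
- near=> n; apply/andP; split; first exact: Lnorm_ge0.
  have n2 : 2 * `|s| + 2 <= n%:R by near: n; exact: nbhs_infty_ger.
  have s0 := normr_ge0 s.
  have w1 : 1 <= n%:R - `|s| by lra.
  apply: le_trans (truncation_error w1) _; rewrite lee_fin /c.
  rewrite [leLHS](_ : _ = 24 * K * Num.sqrt pi * (n%:R - `|s|)^-1);
    last by ring.
  rewrite -[leRHS]mulrA ler_wpM2l ?mulr_ge0 ?sqrtr_ge0//.
  have w0 : 0 < n%:R - `|s| by lra.
  rewrite /= -[leLHS]mul1r ler_pdivrMr// mulrAC ler_pdivlMr// mul1r.
  by rewrite -[X in X <= _]natr1; lra.
- exact: cvg_cst.
- apply: cvg_EFin; first exact: nearW.
  rewrite -[X in _ --> X](mulr0 c).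
  by apply: cvgM; [exact: cvg_cst|exact: cvg_harmonic].
Unshelve. all: by end_near. Qed.

Let Rintegral_cutoffT (h : R -> R) :
  \int[mu]_l (cutoff g l * h l) = \int[mu]_(l in `[-1, 1]) (g l * h l).
Proof.
rewrite [RHS]Rintegral_mkcond; apply: eq_Rintegral => l _.
rewrite patchE mem_setE in_itv/=; case: ifPn => l1; first by rewrite cutoff_in.
by rewrite cutoff_out// mul0r.
Qed.

(** The transform of the translate is the cut-off [g] times a phase. *)
Lemma band_limited_cosT : band_limited (fun x => (cosT g (x - s))%:C).
Proof.
split; first exact: L2_f.
exists F; split; first exact: L2_fourier_fF.
  apply: aeW => k; rewrite /= in_itv/= => /negP k1.
  by rewrite /F cutoff_out// mul0r.
move=> x; apply/eqP; rewrite eq_complex; apply/andP; split; apply/eqP.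
- rewrite /= -/I /I /cosT -Rintegral_cutoffT; apply: eq_Rintegral => k _.
  by rewrite cosN sinN mulrBr cosB; ring.
- rewrite /= -[LHS](sinT_even (x - s) cg gN) /sinT -Rintegral_cutoffT.
  apply: eq_Rintegral => k _.
  by rewrite /= cosN sinN mulrBr sinB; ring.
Qed.

End band_limited_transform.

(** * Values of the transforms at a positive point *)

Section growth.
Local Open Scope classical_set_scope.
Local Open Scope ring_scope.
Variable R : realType.

Lemma harmonic_unbounded (M : R) : exists n, M <= \sum_(i < n) (i.+1%:R)^-1.
Proof.
apply: contrapT => noM; apply: (@dvg_harmonic R).
apply: nondecreasing_is_cvgn.
  by apply/nondecreasing_series => n _ _; exact: harmonic_ge0.
exists M => _ [n _ <-]; rewrite leNgt; apply/negP => Mn; apply: noM; exists n.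
by rewrite ltW// (lt_le_trans Mn)// /series/= big_mkord.
Qed.

Lemma prod_ge_sum (n : nat) (X Y z : nat -> R) :
  (forall i, (i < n)%N -> 0 <= z i) -> (forall i, (i < n)%N -> 0 <= Y i) ->
  (forall i, (i < n)%N -> (1 + z i) * Y i <= X i) ->
  (1 + \sum_(i < n) z i) * \prod_(i < n) Y i <= \prod_(i < n) X i.
Proof.
elim: n => [|n IHn] z0 Y0 XY; first by rewrite !big_ord0 addr0 mulr1.
have {}IHn := IHn (fun i h => z0 i (ltnW h)) (fun i h => Y0 i (ltnW h))
  (fun i h => XY i (ltnW h)).
rewrite !big_ord_recr/=.
have PY0 : 0 <= \prod_(i < n) Y i by apply: prodr_ge0 => i _; apply: Y0;
  exact/ltnW/ltn_ord.
have S0 : 0 <= \sum_(i < n) z i by apply: sumr_ge0 => i _; apply: z0;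
  exact/ltnW/ltn_ord.
have XYn := XY _ (ltnSn n); have zn := z0 _ (ltnSn n);
  have Yn := Y0 _ (ltnSn n).
apply: (@le_trans _ _ ((1 + \sum_(i < n) z i) * \prod_(i < n) Y i * ((1 + z n)
  * Y n))).
  rewrite (_ : _ * (_ * Y n) = (\prod_(i < n) Y i * Y n) * (1 + (\sum_(i < n) z
    i + z n))); last by ring.
  rewrite [leRHS](_ : _ = (\prod_(i < n) Y i * Y n) *
    ((1 + \sum_(i < n) z i) * (1 + z n))); last by ring.
  by rewrite ler_wpM2l ?mulr_ge0//; nra.
by rewrite ler_pM ?mulr_ge0 ?addr_ge0.
Qed.

(** The polynomial whose zeros are the zeros of [sin] that are not zeros of
    [cosT (cospow q)]; the factor of index [i] vanishes at distance
    [(i + 1) * pi] from [(q + 1) * pi]. *)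
Definition zeros_poly (q : nat) (v : R) : R :=
  v * \prod_(i < q) (v ^+ 2 - ((q%:R - i%:R) * pi) ^+ 2).

Lemma zeros_poly_cosT q : exists2 A : R, 0 < A &
  forall v, `|zeros_poly q v * cosT (cospow q) v| = A * `|sin v|.
Proof.
elim: q => [|q [A A0 IHq]].
  exists 2 => // v; rewrite /zeros_poly big_ord0 mulr1 cosT_cospow0.
  by rewrite normrM ger0_norm.
pose k : R := pi ^+ 2 / 4 * (q.*2.+2)%:R * (q.*2.+1)%:R.
have k0 : 0 < k by rewrite !mulr_gt0 ?invr_gt0 ?ltr0n ?pi_gt0.
exists (k * A) => [|v]; first by rewrite mulr_gt0.
rewrite -mulrA -IHq -(gtr0_norm k0) -normrM -[in RHS]normrN; congr `|_|.
rewrite /zeros_poly big_ord_recl subr0.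
transitivity (v * \prod_(i < q) (v ^+ 2 - ((q%:R - i%:R) * pi) ^+ 2) *
  ((v ^+ 2 - (q.+1%:R * pi) ^+ 2) * cosT (cospow q.+1) v)).
  rewrite (eq_bigr (fun i : 'I_q => v ^+ 2 - ((q%:R - i%:R) * pi) ^+ 2)).
    by ring.
  move=> i _; congr (_ - (_ * _) ^+ 2).
  by rewrite -!natr1; ring.
by rewrite cosT_cospow_rec -/k; ring.
Qed.

Lemma zeros_factor_gt0 (q i : nat) (v : R) : (i < q)%N -> q%:R * pi < v ->
  0 < v ^+ 2 - ((q%:R - i%:R) * pi) ^+ 2.
Proof.
move=> iq qv; have p0 := pi_gt0 R.
have q0 : 0 <= q%:R - i%:R :> R by rewrite subr_ge0 ler_nat ltnW.
have c0 : 0 <= (q%:R - i%:R) * pi :> R by rewrite mulr_ge0// ltW.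
have cv : (q%:R - i%:R) * pi < v.
  by apply: le_lt_trans qv; rewrite ler_pM2r// gerBl.
by rewrite subr_gt0 ltr_pXn2r// ?nnegrE// ltW// (le_lt_trans c0).
Qed.

Lemma zeros_poly_gt0 q v : q%:R * pi < v -> 0 < zeros_poly q v.
Proof.
move=> qv; rewrite mulr_gt0//.
  by apply: le_lt_trans qv; rewrite mulr_ge0// pi_ge0.
by apply: prodr_gt0 => i _; exact: zeros_factor_gt0.
Qed.

Lemma zeros_poly_le q a v : q%:R * pi < a -> a <= v ->
  zeros_poly q a <= zeros_poly q v.
Proof.
move=> qa av; have a0 : 0 < a by apply: le_lt_trans qa;
  rewrite mulr_ge0// pi_ge0.
rewrite ler_pM ?(ltW a0)//.
  by rewrite ltW//; apply: prodr_gt0 => i _; exact: zeros_factor_gt0.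
apply: ler_prod => i _; rewrite ltW ?zeros_factor_gt0//= lerD2r.
by rewrite ler_pXn2r// ?nnegrE ltW// (lt_le_trans a0).
Qed.

(** Moving left by [y] from the first remaining zero, the factor at distance
    [(i + 1) * pi] shrinks by a ratio at least [1 + y / ((i + 1) * pi)]. *)
Lemma zeros_poly_ratio q (a y : R) : a = q.+1%:R * pi -> 0 <= y -> y < pi ->
  (1 + \sum_(i < q) y / (i.+1%:R * pi)) * zeros_poly q (a - y) <=
  zeros_poly q a.
Proof.
move=> aq y0 yp; have p0 := pi_gt0 R.
have aE : a = q%:R * pi + pi by rewrite aq -natr1 mulrDl mul1r.
have qay : q%:R * pi < a - y by rewrite aE; lra.
have ay0 : 0 < a - y by apply: le_lt_trans qay; rewrite mulr_ge0// ltW.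
rewrite /zeros_poly mulrCA ler_pM//; [exact: ltW| |by rewrite gerBl|].
  apply: mulr_ge0; last by apply: prodr_ge0 => i _;
    rewrite ltW ?zeros_factor_gt0.
  by rewrite addr_ge0// sumr_ge0// => i _; rewrite divr_ge0// mulr_ge0// ltW.
apply: (@prod_ge_sum q
  (fun i => a ^+ 2 - ((q%:R - i%:R) * pi) ^+ 2)
  (fun i => (a - y) ^+ 2 - ((q%:R - i%:R) * pi) ^+ 2)
  (fun i => y / (i.+1%:R * pi))) => i iq.
- by rewrite divr_ge0// mulr_ge0// ltW.
- by rewrite ltW// zeros_factor_gt0.
pose c := i.+1%:R * pi : R; pose d := (q%:R - i%:R) * pi : R.
have ac : a = d + c by rewrite aE /c /d -natr1; ring.
have d0 : 0 <= d by rewrite mulr_ge0 ?(ltW p0)// subr_ge0 ler_nat ltnW.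
have c0 : pi <= c by rewrite ler_peMl ?(ltW p0)// ler1n.
have cp : 0 < c := lt_le_trans p0 c0.
have cy : (1 + y / c) * (c - y) <= c.
  have cyE (b : R) : 0 < b -> (1 + y / b) * (b - y) = b - y ^+ 2 / b.
    by move=> b0; field; rewrite gt_eqF.
  by rewrite cyE// gerBl divr_ge0 ?sqr_ge0// ltW.
rewrite -/c -/d ac !subr_sqr.
rewrite (_ : d + c - y - d = c - y); last by ring.
rewrite (_ : d + c - d = c); last by ring.
have yc : y <= c by apply: ltW; exact: lt_le_trans c0.
have l0 : 0 <= (1 + y / c) * (c - y).
  by rewrite mulr_ge0 ?subr_ge0// addr_ge0// divr_ge0// ltW.
by clearbody c d; rewrite mulrA ler_pM//; lra.
Qed.

(** The function is [zeros_poly q a / A * cosT (cospow q) (z - s)], where [A]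
    is the constant of [zeros_poly_cosT].  The shift by [s] sends [z <= 0] into
    [u <= - a] and [x] to [y - a], with [y] at most 1 so that it stays in
    ]0, pi[. *)
Lemma classB_real_unbounded (x M : R) : 0 < x ->
  exists2 f, classB_real f & M <= normc (f x).
Proof.
move=> x0; have p0 := pi_gt0 R; have p2 := pi_ge2 R.
pose y := Num.min x 1.
have y0 : 0 < y by rewrite lt_min x0 ltr01.
have yx : y <= x by rewrite ge_min lexx.
have y1 : y <= 1 by rewrite ge_min lexx orbT.
have siny : 0 < sin y by apply: sin_gt0_pi; lra.
have w0 : 0 < sin y * (y / pi) by rewrite mulr_gt0// divr_gt0.
have [n nM] := harmonic_unbounded (M / (sin y * (y / pi))).
pose q := n.+1; pose a : R := q.+1%:R * pi.
have [A A0 AI] := zeros_poly_cosT q.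
have qa : q%:R * pi < a by rewrite /a -natr1 mulrDl mul1r ltrDl.
have qay : q%:R * pi < a - y by rewrite /a -natr1 mulrDl mul1r; lra.
have Da := zeros_poly_gt0 qa; have Day := zeros_poly_gt0 qay.
pose c := zeros_poly q a / A; have c0 : 0 < c by rewrite divr_gt0.
pose s := a + (x - y).
pose g l := c * cospow q l.
have ccos : continuous (cospow (R := R) q) by exact: continuous_cospow.
have cg : continuous g by apply: continuous_mulR => //; exact: continuous_cstR.
have gT u : cosT g u = c * cosT (cospow q) u.
  rewrite /cosT -RintegralZl//.
    by apply: eq_Rintegral => l _; rewrite /g mulrA.
  by apply/continuous_integrable_itv/continuous_mulR => //;
    exact: continuous_cos_mul.
have gS u : sinT (fun l => l * g l) u = c * sinT (fun l => l * cospow q l) u.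
  rewrite /sinT -RintegralZl//.
    by apply: eq_Rintegral => l _; rewrite /g; ring.
  apply/continuous_integrable_itv/continuous_mulR;
    last exact: continuous_sin_mul.
  by apply: continuous_mulR => //; exact: continuous_idR.
have [K KI] := cosT_cospow_decay R n.
have band : band_limited (fun x => (cosT g (x - s))%:C)%C.
  apply: (@band_limited_cosT R g c (c * K)) => //.
  - by move=> l; rewrite normrM gtr0_norm// ler_piMr ?(ltW c0)//
    normr_cospow_le1.
  - by move=> l; rewrite /g cospowN.
  - by rewrite /g cospow1 mulr0.
  - by move=> u; rewrite gT normrM gtr0_norm// mulrCA ler_pM2l//;
    have [] := KI u.
  - move=> u; rewrite normrN gS normrM gtr0_norm// mulrCA ler_pM2l//.
    by have [] := KI u.
have normcE z : normc ((z : R)%:C)%C = `|z| by rewrite /= expr0n addr0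
  sqrtr_sqr.
exists (fun x => (cosT g (x - s))%:C)%C; first split; first split=> //.
  move=> z z0; rewrite normcE gT normrM (gtr0_norm c0).
  have av : a <= s - z by rewrite /s; lra.
  rewrite -[z - s]opprB cosTN; set v := s - z in av *.
  have Dv := lt_le_trans Da (zeros_poly_le qa av).
  have := AI v; rewrite normrM (gtr0_norm Dv) => AIv.
  rewrite /c -mulrA mulrCA -ler_pdivlMl ?invr_gt0// invrK mulr1.
  have : zeros_poly q a * `|cosT (cospow q) v| <= zeros_poly q v * `|cosT
    (cospow q) v|.
    by rewrite ler_wpM2r// zeros_poly_le.
  rewrite AIv => /le_trans; apply.
  by rewrite ler_piMr ?(ltW A0)// sin_max.
  by [].
change (M <= normc ((cosT g (x - s))%:C)%C);
  rewrite normcE gT normrM (gtr0_norm c0).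
rewrite (_ : x - s = - (a - y)); last by rewrite /s; ring.
rewrite cosTN.
have sinay : `|sin (a - y)| = sin y.
  rewrite /a mulr_natl addrC (alternatingn (@sinDpi R)) normrM normrX normrN1
    expr1n mul1r.
  by rewrite sinN normrN gtr0_norm.
have -> : `|cosT (cospow q) (a - y)| = A * sin y / zeros_poly q (a - y).
  have := AI (a - y); rewrite normrM (gtr0_norm Day) sinay => <-.
  by rewrite mulrC mulKf// gt_eqF.
have -> : c * (A * sin y / zeros_poly q (a - y)) =
    sin y * zeros_poly q a / zeros_poly q (a - y).
  by rewrite /c; field; rewrite !gt_eqF.
rewrite ler_pdivlMr// -ler_pdivrMl//.
have ratio := zeros_poly_ratio (erefl a) (ltW y0) (le_lt_trans y1 (lt_le_trans
  (ltr1n _ 2) p2)).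
apply: le_trans ratio; rewrite mulrA ler_wpM2r ?(ltW Day)//.
rewrite (eq_bigr (fun i : 'I_q => y / pi * (i.+1%:R)^-1)); last first.
  by move=> i _; rewrite invfM; ring.
rewrite -mulr_sumr big_ord_recr/= ler_pdivrMl//.
move: nM; rewrite ler_pdivrMr// => /le_trans; apply.
rewrite [leRHS](_ : _ = sin y + sin y * (y / pi) * (n.+1%:R)^-1 +
  (\sum_(i < n) i.+1%:R^-1) * (sin y * (y / pi))); last by ring.
by rewrite lerDr addr_ge0 ?(ltW siny)// mulr_ge0 ?(ltW w0)// invr_ge0.
Qed.

End growth.

Local Open Scope ring_scope.

Theorem mainTheorem1 (R : realType) (x : R) (hx : 0 < x) :
  sup_abs_at (@classB R) x = +oo%E /\ sup_abs_at (@classB_real R) x = +oo%E.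
Proof.
split; apply/eqyP => A _; have [f [fB fR] Af] := classB_real_unbounded A hx.
- apply: (@le_trans _ _ (normc (f x))%:E); first by rewrite lee_fin.
  by apply: ereal_sup_ubound; exists f.
- apply: (@le_trans _ _ (normc (f x))%:E); first by rewrite lee_fin.
  by apply: ereal_sup_ubound; exists f.
Qed.
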